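(* Fix an integer $d\ge 1$. Let $\lambda$ be a partition of $n$ with $\ell(\lambda)\le d$ (set $\lambda_i=0$ for $i>\ell(\lambda)$). Then, as an identity of rational functions in the indeterminate $\beta$, $$\sum_{T\in\operatorname{SIT}(\lambda)}\ \prod_{k=1}^{m(T)}\left(\left[\prod_{i=1}^d \frac{1+\beta\big(\nu_i(T_{<k})+d-i+1\big)}{1+\beta\big(\lambda_i+d-i+1\big)}\right]-1\right)^{-1} \;=\; \frac{1}{(-\beta)^{n}}\prod_{i=1}^{\ell(\lambda)}\big(1+\beta(\lambda_i+d-i+1)\big)^{\lambda_i}\prod_{(i,j)\in\lambda}\frac{1}{h(i,j)}.$$
   Context: Partitions are identified with Young diagrams $\{(i,j): 1\le j\le \lambda_i\}$ (English convention, $i$ = row, $j$ = column); $\lambda'$ is the conjugate partition and $h(i,j)=\lambda_i-j+\lambda'_j-i+1$ is the hook length. A standard increasing tableau of shape $\lambda$ is a filling $T$ of the cells of $\lambda$ by positive integers, strictly increasing left to right along rows and top to bottom down columns, whose set of entries is exactly $\{1,\dots,m\}$ for some $m$; this $m$ is denoted $m(T)$, and $\operatorname{SIT}(\lambda)$ is the set of such tableaux. For $k\ge1$, $T_{<k}$ denotes the set of cells with entry strictly less than $k$; it is a Young diagram of a partition denoted $\nu(T_{<k})$, with parts $\nu_i(T_{<k})$ ($=0$ for $i$ beyond its length). *)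

(* Defs.v *)
From HB Require Import structures.
From mathcomp Require Import all_boot all_order all_algebra fraction.
Set Implicit Arguments. Unset Strict Implicit. Unset Printing Implicit Defensive.
Import Order.TTheory GRing.Theory Num.Theory.

Definition is_partition (lam : seq nat) : bool :=
  sorted geq lam && all (fun x => 0 < x) lam.

Definition part (lam : seq nat) (i : nat) : nat := nth 0 lam i.-1.

Definition conj_part (lam : seq nat) (j : nat) : nat := count (fun x => j <= x) lam.

Definition hook (lam : seq nat) (i j : nat) : nat :=
  part lam i - j + conj_part lam j - i + 1.

(* Fillings.  The cell (i,j) : 'I_d * 'I_n stands for the paper's cell
   (i+1, j+1).  A filling of shape lam is encoded as a finite function whose
   value is a positive integer on the cells of lam and 0 elsewhere. *)
Definition filling (d n : nat) := {ffun 'I_d * 'I_n -> 'I_n.+1}.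

Definition in_shape (lam : seq nat) d n (c : 'I_d * 'I_n) : bool :=
  c.2 < part lam c.1.+1.

Definition mT d n (T : filling d n) : nat := \max_(c : 'I_d * 'I_n) (T c : nat).

Definition is_SIT (lam : seq nat) d n (T : filling d n) : bool :=
  [forall c, (0 < T c) == in_shape lam c] &&
  [forall c, forall c', (in_shape lam c && in_shape lam c' &&
        (c.1 == c'.1) && (c.2 < c'.2)) ==> (T c < T c')] &&
  [forall c, forall c', (in_shape lam c && in_shape lam c' &&
        (c.2 == c'.2) && (c.1 < c'.1)) ==> (T c < T c')] &&
  [forall k : 'I_n.+1, ((0 < k) && (k <= mT T)) ==>
        [exists c, in_shape lam c && (T c == k)]].

(* nu_i(T_{<k}) for the paper's (1-indexed) row i = i0+1 : number of cells of
   row i with entry strictly less than k (= the i-th part of nu(T_{<k})). *)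
Definition nu_part (lam : seq nat) d n (T : filling d n) (k : nat) (i0 : 'I_d) : nat :=
  #|[set j : 'I_n | in_shape lam (i0, j) && (T (i0, j) < k)]|.

Definition RF := {fraction {poly rat}}.
Definition beta : RF := @FracField.tofrac _ ('X : {poly rat}).

(* Main.v *)
(* Only the chain of shapes of a tableau matters, so the left-hand side is the
   solution at the empty shape of a linear recursion on the shapes nu inside
   lambda: (w(nu)/w(lambda) - 1) G(nu) is the sum of G(nu + S) over the nonempty
   sets S of addable cells, where w(nu) = prod_i (1 + beta (nu_i + d - i + 1)),
   normalised by G(lambda) = 1.  This is the Chevalley rule for factorial
   Grothendieck polynomials localised at lambda.  A determinant satisfying the
   rule is triangular at nu = lambda and a Vandermonde determinant at the empty
   shape; the quotient of the two values is the right-hand side, by Frobenius'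
   formula for the product of the hook lengths of a row. *)

Require Import Defs.
From HB Require Import structures.
From mathcomp Require Import all_boot all_order all_algebra fraction.
From mathcomp Require Import perm zify ring.
Import Order.TTheory GRing.Theory Num.Theory.
Local Open Scope ring_scope.

Set Implicit Arguments. Unset Strict Implicit. Unset Printing Implicit Defensive.

(** * A determinant satisfying the Chevalley rule *)

(** Analogue of the factorial power, up to normalisation: for nonzero [c] it vanishes at
    [y = 1 / c m] with [1 <= m <= l], the source of all vanishing below. *)
Definition shiftp (F : fieldType) (c : nat -> F) (l : nat) (y : F) : F :=
  \prod_(m < l) (y * c m.+1 - 1).

(* [nu_j + d - j] for the paper's 1-indexed row [j]. *)
Definition beta_index d (nu : 'I_d -> nat) (j : 'I_d) : nat := (nu j + (d - j.+1))%N.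

(* Up to normalisation, [\det groth_mx] is the numerator of the bialternant
   formula for the factorial Grothendieck polynomial of [nu]. *)
Definition groth_mx (F : fieldType) (c : nat -> F) d (y : 'I_d -> F)
    (nu : 'I_d -> nat) : 'M[F]_d :=
  \matrix_(i, j) (shiftp c (beta_index nu j) (y i) * y i ^+ j).

(* Row [j] of [nu] can be extended by one cell. *)
Definition corner d (nu : 'I_d -> nat) (j : 'I_d) : bool :=
  [forall k : 'I_d, (k < j)%N ==> (nu j < nu k)%N].

Definition antitone d (nu : 'I_d -> nat) : Prop :=
  forall i j : 'I_d, (i <= j)%N -> (nu j <= nu i)%N.

Definition add_cells d (nu : 'I_d -> nat) (S : {set 'I_d}) (j : 'I_d) : nat :=
  (nu j + (j \in S))%N.

Lemma shiftpS (F : fieldType) (c : nat -> F) l y :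
  shiftp c l.+1 y = shiftp c l y * (y * c l.+1 - 1).
Proof. by rewrite /shiftp big_ord_recr. Qed.

(** Multilinearity in the columns, [S] being the set of columns taken from [A]. Transposing makes
    each Leibniz term a product over columns, which expands over subsets. *)
Lemma det_add_cols (F : fieldType) d (A B : 'M[F]_d) :
  \det (A + B) =
    \sum_(S : {set 'I_d}) \det (\matrix_(i, j) (if j \in S then A i j else B i j)).
Proof.
rewrite -det_tr.
rewrite [RHS](eq_bigr (fun S : {set 'I_d} =>
  \det (\matrix_(j, i) (if j \in S then A i j else B i j)))); last first.
  by move=> S _; rewrite -det_tr; congr (\det _); apply/matrixP=> i j; rewrite !mxE.
rewrite /determinant exchange_big; apply: eq_bigr => s _ /=.
rewrite -big_distrr; congr (_ * _) => /=.
transitivity (\prod_i (A (s i) i + B (s i) i)).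
  by apply: eq_bigr => i _; rewrite !mxE.
rewrite bigA_distr; apply: eq_bigr => S _; apply: eq_bigr => i _.
by rewrite mxE.
Qed.

(** Some earlier row is no longer than row [j]; antitonicity then forces equality for the rows in
    between, in particular for row [j - 1]. *)
Lemma noncorner_pred d (nu : 'I_d -> nat) (j : 'I_d) : antitone nu ->
  ~~ corner nu j -> exists2 k : 'I_d, k.+1 = j & nu k = nu j.
Proof.
move=> anu /forallPn[k]; rewrite negb_imply -leqNgt => /andP[kj le].
have kd : (j.-1 < d)%N by have := ltn_ord j; lia.
exists (Ordinal kd) => /=; first by lia.
apply/eqP; rewrite eqn_leq; apply/andP; split; last by apply: anu => /=; lia.
by apply: leq_trans le; apply: anu => /=; lia.
Qed.

(* With [l = beta_index nu], column [j] of [c (l j).+1 * y * groth_mx nu] is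
   [M_j = (shiftp (l j).+1 + shiftp (l j)) * y ^ j].  If [j] is not a corner
   then [l j.-1 = (l j).+1], so the first summand of [M_j] is a multiple of
   [M_(j.-1)]: column operations leave a cell to be added at corners only. *)
Lemma groth_chevalley (F : fieldType) (c : nat -> F) d (y : 'I_d -> F)
    (nu : 'I_d -> nat) :
  antitone nu -> (forall m, c m != 0) ->
  (\prod_i (y i * c (beta_index nu i).+1)) * \det (groth_mx c y nu) =
  \sum_(S : {set 'I_d} | [forall i in S, corner nu i])
     \det (groth_mx c y (add_cells nu S)).
Proof.
move=> anu c0.
pose l := beta_index nu.
pose M : 'M[F]_d := \matrix_(i, j) (y i * c (l j).+1 * (shiftp c (l j) (y i) * y i ^+ j)).
pose C : 'M[F]_d := \matrix_(i, j)
  ((if corner nu j then shiftp c (l j).+1 (y i) * y i ^+ j else 0) +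
   shiftp c (l j) (y i) * y i ^+ j).
(* Right multiplication by the unitriangular [U] subtracts a multiple of column [j - 1] from each
   noncorner column [j]. *)
pose U : 'M[F]_d := \matrix_(k, j)
  ((k == j)%:R - (if ~~ corner nu j && (k.+1 == j) then (c (l k).+1)^-1 else 0)).
have detM : \det M = (\prod_i (y i * c (l i).+1)) * \det (groth_mx c y nu).
  have -> : M = diag_mx (\row_i y i) *m groth_mx c y nu *m diag_mx (\row_j c (l j).+1).
    apply/matrixP=> i j; rewrite mul_mx_diag mul_diag_mx !mxE -/l; ring.
  rewrite !det_mulmx !det_diag big_split /=.
  rewrite (eq_bigr y) => [|i _]; last by rewrite mxE.
  rewrite [X in _ * X](eq_bigr (fun i => c (l i).+1)) => [|i _]; last by rewrite mxE.
  ring.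
have detU : \det U = 1.
  rewrite -det_tr det_trig.
    apply: big1 => i _; rewrite !mxE eqxx.
    by case: ifP => [/andP[_ /eqP]|]; [lia|rewrite subr0].
  apply/is_trig_mxP => i j ij; rewrite !mxE.
  rewrite (_ : (j == i) = false); last by apply/eqP => e; move: ij; rewrite e; lia.
  by case: ifP => [/andP[_ /eqP]|]; [lia|rewrite subr0].
have CMU : C = M *m U.
  apply/matrixP=> i j; rewrite !mxE.
  under eq_bigr => k _ do rewrite [U k j]mxE mulrBr.
  rewrite sumrB (bigD1 j) //= eqxx mulr1 big1 ?addr0; last first.
    by move=> k /negbTE ->; rewrite mulr0.
  have E : M i j = shiftp c (l j).+1 (y i) * y i ^+ j + shiftp c (l j) (y i) * y i ^+ j.
    by rewrite mxE shiftpS; ring.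
  have [cj|ncj] := boolP (corner nu j).
    by rewrite big1 ?subr0 ?E // => k _; rewrite /= mulr0.
  have [k kj nukj] := noncorner_pred anu ncj.
  rewrite (bigD1 k) //= kj eqxx big1 ?addr0; last first.
    move=> k' k'k; case: eqP => [e|]; last by rewrite mulr0.
    case/negP: k'k; apply/eqP/val_inj => /=; lia.
  rewrite E mxE.
  have lk : l k = (l j).+1.
    by rewrite /l /beta_index nukj; have := ltn_ord j; lia.
  rewrite add0r lk -kj exprS.
  by field.
rewrite -/l -detM.
have -> : \det M = \det C by rewrite CMU det_mulmx detU mulr1.
have -> : C = (\matrix_(i, j) (if corner nu j then shiftp c (l j).+1 (y i) * y i ^+ j else 0))
   + groth_mx c y nu by apply/matrixP=> i j; rewrite !mxE.
rewrite det_add_cols [LHS](bigID (fun S : {set 'I_d} => [forall i in S, corner nu i])) /=.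
rewrite [X in _ + X]big1 ?addr0.
  apply: eq_bigr => S /forall_inP HS; congr (\det _); apply/matrixP => i j; rewrite !mxE.
  case: ifP => jS; rewrite /beta_index /add_cells jS ?addn0 //.
  by rewrite (HS j jS) addn1 addSn.
(* A noncorner [j] in [S] selects a zero column. *)
move=> S; rewrite negb_forall => /existsP[j]; rewrite negb_imply => /andP[jS ncj].
rewrite (expand_det_col _ j) big1 // => i _.
by rewrite !mxE jS (negbTE ncj) mul0r.
Qed.

(** * Vanishing of the determinant, and its values at [la] and at the empty shape *)

(** The zero block has [d - k] rows and [k + 1] columns, so every permutation meets it: otherwise
    the indices from [k] on would inject into those strictly after [k]. *)
Lemma det_zero_block (F : fieldType) d (A : 'M[F]_d) (k : 'I_d) :
  (forall i j : 'I_d, (k <= i)%N -> (j <= k)%N -> A i j = 0) -> \det A = 0.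
Proof.
move=> A0; rewrite /determinant big1 // => s _.
have [i ki sik] : exists2 i : 'I_d, (k <= i)%N & (s i <= k)%N.
  apply/exists_inP; apply: contraT => /exists_inPn H.
  have sub : s @: [set i : 'I_d | (k <= i)%N] \subset [set i : 'I_d | (k <= i)%N] :\ k.
    apply/subsetP => x /imsetP[i ki ->]; move: ki; rewrite !inE => ki.
    have := H i ki; rewrite -ltnNge => lt; rewrite (ltnW lt) andbT.
    by apply/eqP => e; move: lt; rewrite e ltnn.
  have := subset_leq_card sub; rewrite card_imset; last exact: perm_inj.
  by rewrite (cardsD1 k [set i : 'I_d | (k <= i)%N]) inE leqnn add1n ltnn.
by rewrite (bigD1 i) //= A0 // mul0r mulr0.
Qed.

(** For [i >= k >= j] one has [la i <= la k < nu k <= nu j], so [shiftp] contains the factor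
    vanishing at [y i]; this gives a zero block. *)
Lemma groth_vanish (F : fieldType) (c : nat -> F) d (la nu : 'I_d -> nat) (k : 'I_d) :
  antitone la -> antitone nu -> (forall m, c m != 0) -> (la k < nu k)%N ->
  \det (groth_mx c (fun i => (c (beta_index la i).+1)^-1) nu) = 0.
Proof.
move=> ala anu c0 lt; apply: (det_zero_block (k := k)) => i j ki jk.
have h : (beta_index la i < beta_index nu j)%N.
  have := ala _ _ ki; have := anu _ _ jk; rewrite /beta_index.
  have := ltn_ord i; have := ltn_ord j; lia.
rewrite mxE /shiftp (bigD1 (Ordinal h)) //= mulVf // subrr; ring.
Qed.

(** The same factor kills the entries below the diagonal, since [beta_index la] strictly
    decreases. *)
Lemma groth_diag (F : fieldType) (c : nat -> F) d (la : 'I_d -> nat) :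
  antitone la -> (forall m, c m != 0) ->
  let y i := (c (beta_index la i).+1)^-1 in
  \det (groth_mx c y la) =
  \prod_i (shiftp c (beta_index la i) (y i) * y i ^+ i).
Proof.
move=> ala c0 y; rewrite -det_tr det_trig; first by apply: eq_bigr => i _; rewrite !mxE.
apply/is_trig_mxP => j i ij; rewrite !mxE.
have h : (beta_index la i < beta_index la j)%N.
  have := ala _ _ (ltnW ij); rewrite /beta_index.
  have := ltn_ord i; have := ltn_ord j; lia.
by rewrite /shiftp (bigD1 (Ordinal h)) //= mulVf // subrr !mul0r.
Qed.

Lemma big_ord_gt (R : Type) (idx : R) (op : Monoid.com_law idx) d i (F : nat -> R) :
  \big[op/idx]_(j < d | (i < j)%N) F j = \big[op/idx]_(0 <= k < d - i.+1) F (k + i.+1)%N.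
Proof.
rewrite -(big_mkord (fun j => i < j)%N).
have [di|id] := leqP d i.
  rewrite [RHS]big_geq; last by lia.
  by rewrite big_nat_cond big1 // => j; lia.
rewrite (big_cat_nat (n := i.+1)) //= big_nat_cond big1 ?Monoid.mul1m; last by move=> j; lia.
rewrite big_nat_cond (eq_bigl (fun j => i.+1 <= j < d)%N) => [|j]; last by lia.
by rewrite -big_nat -{1}[i.+1]add0n big_addn.
Qed.

Lemma prodr_const_gt (F : fieldType) d (i : 'I_d) (x : F) :
  \prod_(j < d | (i < j)%N) x = x ^+ (d - i.+1).
Proof. by rewrite (big_ord_gt _ _ _ (fun=> x)) prodr_const_nat subn0. Qed.

(** Column [j] holds the values of a polynomial [p j] of degree less than [d] divisible by ['X^j],
    so the matrix is a Vandermonde matrix times a triangular coefficient matrix. *)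
Lemma groth_empty (F : fieldType) (c : nat -> F) d (y : 'I_d -> F) :
  \det (groth_mx c y (fun=> 0%N)) =
  \prod_(i < d) \prod_(j < d | (i < j)%N) (y i - y j).
Proof.
pose p (j : 'I_d) : {poly F} := (\prod_(m < d - j.+1) (c m.+1 *: 'X - 1)) * 'X^j.
pose U : 'M[F]_d := \matrix_(k, j) (p j)`_k.
have szp (j : 'I_d) : (size (p j) <= d)%N.
  apply: leq_trans (size_polyMleq _ _) _; rewrite size_polyXn.
  have H n : (size (\prod_(m < n) (c m.+1 *: 'X - 1 : {poly F}))%R <= n.+1)%N.
    elim: n => [|n IH]; first by rewrite big_ord0 size_poly1.
    rewrite big_ord_recr /=; apply: leq_trans (size_polyMleq _ _) _.
    have sz2 : (size (c n.+1 *: 'X - 1 : {poly F})%R <= 2)%N.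
      apply: leq_trans (size_polyD _ _) _; rewrite size_polyN size_poly1 geq_max andbT.
      by apply: leq_trans (size_scale_leq _ _) _; rewrite size_polyX.
    by rewrite -subn1 leq_subLR; apply: leq_trans (leq_add IH sz2) _; lia.
  rewrite addnS /=; apply: leq_trans (leq_add (H _) (leqnn _)) _.
  have := ltn_ord j; lia.
have -> : groth_mx c y (fun=> 0%N) = (Vandermonde d (\row_i y i))^T *m U.
  apply/matrixP => i j; rewrite !mxE.
  transitivity (p j).[y i].
    rewrite /p hornerM hornerXn horner_prod /shiftp /beta_index add0n; congr (_ * _).
    by apply: eq_bigr => m _; rewrite !hornerE mulrC.
  rewrite (horner_coef_wide _ (szp j)); apply: eq_bigr => k _.
  by rewrite !mxE mulrC.
rewrite det_mulmx det_tr det_Vandermonde det_trig; last first.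
  apply/is_trig_mxP => i j ij; rewrite mxE /p.
  by rewrite coefMXn ij.
rewrite -big_split /=; apply: eq_bigr => i _.
(* The diagonal coefficient is [(-1) ^+ (d - i.+1)]: one sign for each [j > i], reversing the
   Vandermonde differences. *)
rewrite !mxE /p coefMXn ltnn subnn -horner_coef0 horner_prod.
rewrite [X in _ * X](eq_bigr (fun=> -1)) => [|m _]; last by rewrite !hornerE; ring.
rewrite prodr_const card_ord.
rewrite -prodr_const_gt.
by rewrite -big_split /=; apply: eq_bigr => j _; rewrite !mxE; ring.
Qed.

(** * Adding and removing the top layer of a tableau *)

Local Open Scope nat_scope.

Lemma card_ord_lt n m : m <= n -> #|[set x : 'I_n | x < m]| = m.
Proof.
move=> mn; rewrite -sum1dep_card -(big_mkord (fun x => x < m) (fun=> 1)).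
rewrite (big_cat_nat (n := m)) //= [X in _ + X]big_nat_cond [X in _ + X]big1 => [|j]; last by lia.
rewrite big_nat_cond (eq_bigl (fun j => 0 <= j < m)) => [|j]; last by lia.
by rewrite -big_nat sum_nat_const_nat subn0 muln1 addn0.
Qed.

(** Converts row lengths, defined by counting, into a test on column indices. *)
Lemma mem_downset n (A : {set 'I_n}) (j : 'I_n) :
  (forall a b : 'I_n, a < b -> b \in A -> a \in A) -> (j \in A) = (j < #|A|).
Proof.
move=> dA; apply/idP/idP => jA.
  rewrite -(card_ord_lt (ltn_ord j)); apply: subset_leq_card; apply/subsetP => x.
  rewrite inE ltnS leq_eqVlt => /predU1P[/val_inj -> //|xj]; exact: dA jA.
apply: contraLR jA => jA; rewrite -leqNgt -[leqRHS](card_ord_lt (ltnW (ltn_ord j))).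
apply: subset_leq_card; apply/subsetP => x xA; rewrite inE ltnNge leq_eqVlt.
apply/negP => /predU1P[/val_inj e|jx]; first by rewrite e xA in jA.
by rewrite (dA _ _ jx xA) in jA.
Qed.

Definition row_len d n (T : filling d n) (i : 'I_d) : nat :=
  #|[set j : 'I_n | 0 < T (i, j)]|.

(* [0] marks an empty cell, so a partial tableau may occupy any Young diagram
   inside [la]. *)
Definition partial_tab d n (la : 'I_d -> nat) (T : filling d n) : bool :=
  [&& [forall i, forall j : 'I_n, (0 < T (i, j)) ==> (j < la i)],
      [forall i, forall j : 'I_n, forall j' : 'I_n, (j < j') && (0 < T (i, j')) ==>
         (0 < T (i, j) < T (i, j'))],
      [forall j, forall i : 'I_d, forall i' : 'I_d, (i < i') && (0 < T (i', j)) ==>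
         (0 < T (i, j) < T (i', j))] &
      [forall k : 'I_n.+1, (0 < k <= mT T) ==> [exists c, T c == k]]].

Lemma partial_tabP d n (la : 'I_d -> nat) (T : filling d n) :
  reflect [/\ forall i (j : 'I_n), 0 < T (i, j) -> j < la i,
     forall i (j j' : 'I_n), j < j' -> 0 < T (i, j') -> 0 < T (i, j) < T (i, j'),
     forall (i i' : 'I_d) j, i < i' -> 0 < T (i', j) -> 0 < T (i, j) < T (i', j) &
     forall k, 0 < k <= mT T -> exists c, T c = k :> nat]
  (partial_tab la T).
Proof.
have mTn : mT T <= n by apply/bigmax_leqP => c _; rewrite -ltnS.
apply: (iffP and4P) => -[h1 h2 h3 h4]; split.
- by move=> i j; have /forallP/(_ i)/forallP/(_ j)/implyP := h1.
- move=> i j j' jj' T0; have /forallP/(_ i)/forallP/(_ j)/forallP/(_ j')/implyP := h2.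
  by apply; rewrite jj'.
- move=> i i' j ii' T0; have /forallP/(_ j)/forallP/(_ i)/forallP/(_ i')/implyP := h3.
  by apply; rewrite ii'.
- move=> k km; have kn : k < n.+1 by lia.
  have /forallP/(_ (Ordinal kn))/implyP/(_ km)/existsP[c /eqP e] := h4.
  by exists c; rewrite e.
- by apply/forallP => i; apply/forallP => j; apply/implyP/h1.
- apply/forallP => i; apply/forallP => j; apply/forallP => j'.
  by apply/implyP => /andP[]; apply: h2.
- apply/forallP => j; apply/forallP => i; apply/forallP => i'.
  by apply/implyP => /andP[]; apply: h3.
- apply/forallP => k; apply/implyP => /h4[c e]; apply/existsP; exists c.
  exact/eqP/val_inj.
Qed.

Lemma leq_mT d n (T : filling d n) c : T c <= mT T.
Proof. exact: (leq_bigmax c). Qed.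

Lemma row_lenP d n (la : 'I_d -> nat) (T : filling d n) i (j : 'I_n) :
  partial_tab la T -> (0 < T (i, j)) = (j < row_len T i).
Proof.
move=> /partial_tabP[_ h2 _ _]; rewrite /row_len -mem_downset ?inE //.
by move=> a b ab; rewrite !inE => /(h2 _ _ _ ab) /andP[].
Qed.

Lemma row_len_le d n (la : 'I_d -> nat) (T : filling d n) i :
  partial_tab la T -> row_len T i <= la i.
Proof.
move=> pT; rewrite leqNgt; apply/negP => lt.
have lan : la i < n.
  by apply: leq_trans lt _; rewrite -[leqRHS]card_ord; apply: max_card.
have /partial_tabP[h1 _ _ _] := pT.
have := h1 i (Ordinal lan); rewrite (row_lenP _ _ pT) /= ltnn => /(_ lt).
by [].
Qed.

Lemma row_len_antitone d n (la : 'I_d -> nat) (T : filling d n) :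
  partial_tab la T -> antitone (row_len T).
Proof.
move=> /partial_tabP[_ _ h3 _] i j; rewrite leq_eqVlt => /predU1P[/val_inj->//|ij].
apply: subset_leq_card; apply/subsetP => x; rewrite !inE => T0.
by have /andP[] := h3 _ _ _ ij T0.
Qed.

(* Every level [1..mT T] uses a cell of its own. *)
Lemma mT_le_size d n (la : 'I_d -> nat) (T : filling d n) :
  partial_tab la T -> mT T <= \sum_i row_len T i.
Proof.
move=> /partial_tabP[_ _ _ h4].
have mTn : mT T <= n by apply/bigmax_leqP => c _; rewrite -ltnS.
have -> : \sum_i row_len T i = #|[set c | 0 < T c]|.
  rewrite -sum1dep_card (eq_bigr (fun i => \sum_(j | 0 < T (i, j)) 1)).
    by rewrite pair_big_dep /=; apply: eq_bigl => -[].
  by move=> i _; rewrite sum1dep_card.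
apply: leq_trans (leq_imset_card T _).
rewrite -ltnS -[leqLHS](@card_ord_lt n.+1) //.
(* Level [0] is adjoined so that the levels up to [mT T] form an initial segment of ['I_n.+1]. *)
apply: (@leq_trans #|ord0 |: T @: [set c | 0 < T c]|); last first.
  by rewrite cardsU1; case: (_ \notin _); rewrite /= ?add0n ?add1n ?leqnSn ?leqnn.
apply: subset_leq_card; apply/subsetP => k; rewrite !inE ltnS => km.
have [-> //|k0] := eqVneq k ord0; apply/orP; right.
have k0' : 0 < k by rewrite lt0n.
have [|c e] := h4 k; first by rewrite k0'.
by apply/imsetP; exists c; [rewrite inE e|apply: val_inj].
Qed.

Definition top_rows d n (T : filling d n) : {set 'I_d} :=
  [set i | [exists j, T (i, j) == mT T :> nat]].

Definition remove_top d n (T : filling d n) : filling d n :=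
  [ffun c => if T c == mT T :> nat then ord0 else T c].

(** [inord] is faithful only when [mT T < n]; [mT_lt] ensures this while some row is not full. *)
Definition add_top d n (T : filling d n) (S : {set 'I_d}) : filling d n :=
  [ffun c : 'I_d * 'I_n => if (c.1 \in S) && (row_len T c.1 == c.2) then inord (mT T).+1 else T c].

(* The cells of value [mT T] end their rows, since entries increase. *)
Lemma top_cell d n (la : 'I_d -> nat) (T : filling d n) i j :
  partial_tab la T -> 0 < mT T ->
  (T (i, j) == mT T :> nat) = (i \in top_rows T) && (row_len T i == j.+1).
Proof.
move=> pT m0; have /partial_tabP[_ h2 _ _] := pT.
have key j' : T (i, j') = mT T :> nat -> row_len T i = j'.+1.
  move=> e; have lt : j' < row_len T i by rewrite -(row_lenP _ _ pT) e.
  apply/eqP; rewrite eqn_leq lt andbT leqNgt; apply/negP => lt'.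
  have jn : j'.+1 < n.
    by apply: leq_trans lt' _; rewrite -[leqRHS]card_ord; apply: max_card.
  have := lt'; rewrite -[j'.+1]/(nat_of_ord (Ordinal jn)) -(row_lenP _ _ pT).
  by move=> /(h2 i j' (Ordinal jn) (ltnSn _))/andP[_]; rewrite e ltnNge leq_mT.
apply/eqP/andP => [e|[]]; first by rewrite inE (key _ e) eqxx; split => //; apply/existsP; exists j; apply/eqP.
rewrite inE => /existsP[j' /eqP e]; rewrite (key _ e) => /eqP[/val_inj <-].
exact: e.
Qed.

(** No level is skipped, so erasing the largest leaves the preceding one as maximum. *)
Lemma mT_remove d n (la : 'I_d -> nat) (T : filling d n) :
  partial_tab la T -> mT (remove_top T) = (mT T).-1.
Proof.
move=> /partial_tabP[_ _ _ h4]; apply/eqP; rewrite eqn_leq; apply/andP; split.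
  apply/bigmax_leqP => c _; rewrite ffunE; case: eqP => //= e.
  by have := leq_mT T c; lia.
have [m1|m1] := leqP (mT T) 1; first by lia.
have [|c e] := h4 (mT T).-1; first by lia.
have := leq_mT (remove_top T) c; rewrite ffunE; case: eqP; lia.
Qed.

Lemma row_len_remove d n (la : 'I_d -> nat) (T : filling d n) i :
  partial_tab la T -> 0 < mT T ->
  row_len T i = row_len (remove_top T) i + (i \in top_rows T).
Proof.
move=> pT m0; have [iS|niS] := boolP (i \in top_rows T); last first.
  rewrite addn0; apply: eq_card => j; rewrite !inE ffunE (top_cell _ _ pT m0) (negbTE niS).
  by [].
have := iS; rewrite inE => /existsP[j]; rewrite (top_cell _ _ pT m0) => /andP[_ /eqP e].
rewrite addn1 [row_len T i](cardsD1 j) inE (row_lenP _ _ pT) e ltnSn add1n; congr _.+1.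
apply: eq_card => x; rewrite !inE ffunE (top_cell _ _ pT m0) iS e eqSS /=.
have [->|xj] := eqVneq x j; first by rewrite eqxx.
by case: eqP => //= jx; case/eqP: xj; apply: val_inj.
Qed.

Lemma partial_tab_remove d n (la : 'I_d -> nat) (T : filling d n) :
  partial_tab la T -> partial_tab la (remove_top T).
Proof.
move=> pT; have mr := mT_remove pT.
have /partial_tabP[h1 h2 h3 h4] := pT.
have rE c : remove_top T c = (if T c == mT T :> nat then 0 else T c) :> nat.
  by rewrite ffunE; case: ifP.
apply/partial_tabP; split.
- by move=> i j; rewrite rE; case: ifP => // _; apply: h1.
- move=> i j j' jj'; rewrite !rE; case: ifP => // _ T0.
  by have := h2 _ _ _ jj' T0; case: eqP => //; have := leq_mT T (i, j'); lia.
- move=> i i' j ii'; rewrite !rE; case: ifP => // _ T0.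
  by have := h3 _ _ _ ii' T0; case: eqP => //; have := leq_mT T (i', j); lia.
- move=> k; rewrite mr => km; have [|c e] := h4 k; first by lia.
  by exists c; rewrite rE e; case: eqP => //; lia.
Qed.

Lemma add_removeK d n (la : 'I_d -> nat) (T : filling d n) :
  partial_tab la T -> 0 < mT T -> add_top (remove_top T) (top_rows T) = T.
Proof.
move=> pT m0; apply/ffunP => -[i j]; apply: val_inj; rewrite ffunE /=.
have := row_len_remove i pT m0.
rewrite (mT_remove pT) prednK //.
have mn : mT T < n.+1 by rewrite ltnS; apply/bigmax_leqP => c _; rewrite -ltnS.
have [iS|niS] /= := boolP (i \in top_rows T).
  rewrite addn1 => e; case: eqP => ej.
    rewrite inordK //; apply/esym/eqP; rewrite (top_cell _ _ pT m0) iS e ej.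
    by rewrite eqxx.
  by rewrite ffunE (top_cell _ _ pT m0) iS e eqSS; case: eqP.
by move=> _; rewrite ffunE (top_cell _ _ pT m0) (negbTE niS).
Qed.

Lemma top_rows_neq0 d n (la : 'I_d -> nat) (T : filling d n) :
  partial_tab la T -> 0 < mT T -> top_rows T != set0.
Proof.
move=> /partial_tabP[_ _ _ h4] m0; have [|[i j] e] := h4 (mT T); first by rewrite m0 /=.
by apply/set0Pn; exists i; rewrite inE; apply/existsP; exists j; rewrite e.
Qed.

(** A cell above a top cell has a smaller positive entry, so it survives the removal and its row
    stays strictly longer. *)
Lemma top_rows_addable d n (la : 'I_d -> nat) (T : filling d n) i :
  partial_tab la T -> 0 < mT T -> i \in top_rows T ->
  corner (row_len (remove_top T)) i && (row_len (remove_top T) i < la i).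
Proof.
move=> pT m0 iS; have rl := row_len_remove _ pT m0.
have := rl i; rewrite iS addn1 => e; have := row_len_le i pT; rewrite e => ->.
rewrite andbT; apply/forallP => k; apply/implyP => ki.
have := iS; rewrite inE => /existsP[j Tj].
have := Tj; rewrite (top_cell _ _ pT m0) iS e eqSS => /eqP ->.
have pR := partial_tab_remove pT.
have /partial_tabP[_ _ h3 _] := pT.
rewrite -(row_lenP _ _ pR) ffunE.
have /andP[] : 0 < T (k, j) < T (i, j) by apply: h3 => //; rewrite (eqP Tj).
by rewrite (eqP Tj); case: eqP => // ->; rewrite ltnn.
Qed.

Lemma add_topE d n (T : filling d n) (S : {set 'I_d}) i j :
  mT T < n -> add_top T S (i, j) =
    (if (i \in S) && (row_len T i == j) then (mT T).+1 else T (i, j)) :> nat.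
Proof. by move=> mn; rewrite ffunE /=; case: ifP => // _; rewrite inordK. Qed.

(** There are at most as many levels as filled cells, and an incomplete row leaves fewer than [n] of
    these. *)
Lemma mT_lt d n (la : 'I_d -> nat) (T : filling d n) i :
  partial_tab la T -> \sum_i la i = n -> row_len T i < la i -> mT T < n.
Proof.
move=> pT sla lt; apply: leq_ltn_trans (mT_le_size pT) _.
apply: (@leq_trans (\sum_i la i)); last by rewrite sla.
rewrite (bigD1 i) //= [X in _ < X](bigD1 i) //= -addSn leq_add //.
by apply: leq_sum => k _; apply: row_len_le pT.
Qed.

(** With [add_removeK] and [top_rows_addable] this matches nonempty partial tableaux with pairs of a
    partial tableau and a nonempty set of rows extendable inside [la]. *)
Lemma add_topP d n (la : 'I_d -> nat) (T : filling d n) (S : {set 'I_d}) :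
  partial_tab la T -> \sum_i la i = n -> S != set0 ->
  (forall i, i \in S -> corner (row_len T) i && (row_len T i < la i)) ->
  [/\ partial_tab la (add_top T S), 0 < mT (add_top T S),
      remove_top (add_top T S) = T & top_rows (add_top T S) = S].
Proof.
move=> pT sla /set0Pn[i0 i0S] HS.
have /andP[_ lt0] := HS _ i0S; have mn := mT_lt pT sla lt0.
have AE := add_topE S _ _ mn; pose m := mT T; rewrite -/m in AE mn.
have lan i : la i <= n by rewrite -[leqRHS]sla (bigD1 i) //= leq_addr.
have cell i : i \in S -> exists j : 'I_n, row_len T i = j.
  by move=> /HS /andP[_ lt]; exists (Ordinal (leq_trans lt (lan i))).
have Aold c : 0 < T c -> add_top T S c = T c :> nat.
  case: c => i j; rewrite AE (row_lenP _ _ pT) => lt.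
  by rewrite gtn_eqF ?andbF.
have [j0 j0E] := cell _ i0S.
have A0 : add_top T S (i0, j0) = m.+1 :> nat by rewrite AE i0S j0E eqxx.
have mA : mT (add_top T S) = m.+1.
  apply/eqP; rewrite eqn_leq -{2}A0 leq_mT andbT; apply/bigmax_leqP => -[i j] _.
  by rewrite AE; case: ifP => // _; rewrite leqW // leq_mT.
have Atop i j : (add_top T S (i, j) == m.+1 :> nat) = (i \in S) && (row_len T i == j).
  rewrite AE; case: ifP => [_|_]; first by rewrite eqxx.
  by have := leq_mT T (i, j); rewrite -/m; case: eqP => //; lia.
have /partial_tabP[h1 h2 h3 h4] := pT.
split.
- apply/partial_tabP; split.
  + move=> i j; rewrite AE; case: ifP => [/andP[/HS/andP[_ lt] /eqP <-] //|_].
    exact: h1.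
  + move=> i j j' jj'; rewrite [in X in X -> _]AE; case: ifP => [c _|nc].
      have /andP[_ /eqP e] := c.
      have T0 : 0 < T (i, j) by rewrite (row_lenP _ _ pT) e.
      by rewrite Aold // T0 /= AE c ltnS; apply: leq_mT.
    by move=> T0; have := h2 _ _ _ jj' T0 => /andP[p q]; rewrite !Aold ?p ?q.
  + move=> i i' j ii'; rewrite [in X in X -> _]AE; case: ifP => [c _|nc].
      (* The corner condition makes row [i] strictly longer, so the cell above a new cell is already
         filled. *)
      have /andP[/HS/andP[/forallP/(_ i)/implyP/(_ ii') lt _] /eqP e] := c.
      have T0 : 0 < T (i, j) by rewrite (row_lenP _ _ pT) -e.
      by rewrite Aold // T0 /= AE c ltnS; apply: leq_mT.
    by move=> T0; have := h3 _ _ _ ii' T0 => /andP[p q]; rewrite !Aold ?p ?q.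
  + move=> k; rewrite mA => /andP[k0]; rewrite leq_eqVlt => /predU1P[->|km].
      by exists (i0, j0).
    have [|c e] := h4 k; first by rewrite k0.
    by exists c; rewrite Aold // e.
- by rewrite mA.
- apply/ffunP => -[i j]; apply: val_inj; rewrite ffunE mA Atop /=.
  case: ifP => [/andP[_ /eqP e]|c].
    by apply/esym/eqP; rewrite /= -leqn0 leqNgt (row_lenP _ _ pT) e ltnn.
  by rewrite AE c.
- apply/setP => i; rewrite inE mA; apply/existsP/idP => [[j]|iS].
    by rewrite Atop => /andP[].
  by have [j e] := cell _ iS; exists j; rewrite Atop iS e eqxx.
Qed.

(** * Weights and the sum over full tableaux *)

Definition below d n (T : filling d n) (k : nat) (i : 'I_d) : nat :=
  #|[set j : 'I_n | 0 < T (i, j) < k]|.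

(** [u] abstracts the bracketed product of the theorem as a function of the shape [nu(T_{<k})]. *)
Definition tab_weight (F : fieldType) d n (u : ('I_d -> nat) -> F) (T : filling d n) : F :=
  (\prod_(1 <= k < (mT T).+1) (u (below T k) - 1)^-1)%R.

(** The factor [k = mT T] sees exactly the shape of [remove_top T], and the earlier factors do not
    see the top layer. Shapes are functions, so [u] has to respect pointwise equality. *)
Lemma tab_weight_remove (F : fieldType) d n (u : ('I_d -> nat) -> F)
    (la : 'I_d -> nat) (T : filling d n) :
  (forall nu mu, nu =1 mu -> u nu = u mu) ->
  partial_tab la T -> 0 < mT T ->
  tab_weight u T =
    (tab_weight u (remove_top T) * (u (row_len (remove_top T)) - 1)^-1)%R.
Proof.
move=> uext pT m0; rewrite /tab_weight (mT_remove pT) prednK // big_nat_recr //=.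
have belowE k : k <= mT T -> below T k =1 below (remove_top T) k.
  move=> km i; apply: eq_card => j; rewrite !inE ffunE.
  by case: eqP => // e; rewrite e [mT T < k]ltnNge km andbF.
congr (_ * _)%R; last first.
  congr ((_ - 1)^-1)%R; apply: uext => i; rewrite belowE //; apply: eq_card => j.
  rewrite !inE; case: (posnP (remove_top T (i, j))) => // _ /=; rewrite ffunE.
  by case: eqP => // e; rewrite ltn_neqAle leq_mT andbT; apply/eqP.
by apply: eq_big_nat => k /andP[_ km]; congr ((_ - 1)^-1)%R; apply: uext; apply: belowE; exact: ltnW.
Qed.

Lemma partial_tab0 d n (la : 'I_d -> nat) (T : filling d n) :
  (partial_tab la T && (mT T == 0)) = (T == [ffun=> ord0]).
Proof.
apply/andP/eqP => [[_ /eqP m0]|->].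
  apply/ffunP => c; apply: val_inj; rewrite ffunE /=; apply/eqP.
  by rewrite -leqn0 -m0 leq_mT.
have m0 : mT ([ffun=> ord0] : filling d n) = 0.
  by apply: big1 => c _; rewrite ffunE.
rewrite m0; split => //; apply/partial_tabP; split.
- by move=> i j; rewrite ffunE.
- by move=> i j j' _; rewrite !ffunE.
- by move=> i i' j _; rewrite !ffunE.
- by move=> k; rewrite m0; lia.
Qed.

(* Removing the top layer of a nonempty tableau turns the sum of [W T * f(T)]
   over nonempty [T] into the same sum over [T] not filling [la]; comparing
   both with the sum over all [T] leaves the full tableaux and the empty one. *)
Lemma sum_full_tabs (F : fieldType) d n (la : 'I_d -> nat) (u f : ('I_d -> nat) -> F) :
  \sum_i la i = n ->
  (forall nu mu, nu =1 mu -> u nu = u mu) ->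
  (forall nu mu, nu =1 mu -> f nu = f mu) ->
  (forall nu, antitone nu -> (forall i, nu i <= la i) -> (exists i, nu i < la i) ->
     (u nu != 1 /\
     (u nu - 1) * f nu =
       \sum_(S : {set 'I_d} | (S != set0) &&
              [forall i in S, corner nu i && (nu i < la i)%N]) f (add_cells nu S))%R) ->
  ((\sum_(T : filling d n | partial_tab la T && [forall i, row_len T i == la i])
    tab_weight u T) * f la = f (fun=> 0%N))%R.
Proof.
move=> sla uext fext H.
pose full (T : filling d n) := [forall i, row_len T i == la i].
pose g (T : filling d n) : F := (tab_weight u T * f (row_len T))%R.
have step : (\sum_(T | partial_tab la T && ~~ (mT T == 0%N)) g T =
             \sum_(T | partial_tab la T && ~~ full T) g T)%R.
  (* Group the nonempty tableaux by what remains below the top layer, which is never full. *)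
  rewrite (partition_big (@remove_top d n) (fun T => partial_tab la T && ~~ full T)) /=.
    apply: eq_bigr => T' /andP[pT' nfull].
    have ex : exists i, row_len T' i < la i.
      have /forallPn[i ne] := nfull; exists i.
      by rewrite ltn_neqAle ne (row_len_le i pT').
    have [u1 E] := H _ (row_len_antitone pT') (fun i => row_len_le i pT') ex.
    (* Since [u] differs from [1] here, this makes room for the recursion for [f]. *)
    have -> : (g T' = tab_weight u T' * (u (row_len T') - 1)^-1 *
                      ((u (row_len T') - 1) * f (row_len T')))%R.
      rewrite -mulrA mulKf // subr_eq0 //.
    rewrite E big_distrr /=.
    (* The fibre over [T'] is parametrised by the set of rows that receive a top cell. *)
    rewrite (reindex_onto (add_top T') (@top_rows d n)); last first.
      move=> T /andP[/andP[pT m0] /eqP <-]; apply: add_removeK pT _.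
      by rewrite lt0n.
    apply: eq_big => [S|S].
      apply/idP/idP.
        move=> /andP[/andP[/andP[pA m0] /eqP rA] /eqP tA]; rewrite -lt0n in m0.
        rewrite -tA (top_rows_neq0 pA m0) /=; apply/forall_inP => i iS.
        by have := top_rows_addable pA m0 iS; rewrite rA.
      move=> /andP[S0 /forall_inP HS].
      by have [-> m0 -> ->] := add_topP pT' sla S0 HS; rewrite -lt0n m0 !eqxx.
    move=> /andP[/andP[/andP[pA m0] /eqP rA] /eqP tA]; rewrite -lt0n in m0.
    rewrite /g (tab_weight_remove uext pA m0) rA; congr (_ * _)%R; apply: fext => i.
    by rewrite (row_len_remove i pA m0) rA tA.
  move=> T /andP[pT]; rewrite -lt0n => m0; rewrite (partial_tab_remove pT) /=.
  have /set0Pn[i iS] := top_rows_neq0 pT m0.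
  have /andP[_ lt] := top_rows_addable pT m0 iS.
  by apply/forallPn; exists i; rewrite neq_ltn lt.
have tot : (\sum_(T | partial_tab la T && (mT T == 0%N)) g T =
            \sum_(T | partial_tab la T && full T) g T)%R.
  apply: (@addIr _ (\sum_(T | partial_tab la T && ~~ full T) g T)%R).
  by rewrite -{1}step -!bigID.
rewrite big_distrl /=; transitivity (\sum_(T | partial_tab la T && full T) g T)%R.
  apply: eq_bigr => T /andP[_ /forallP fT]; congr (_ * _)%R; apply: fext => i.
  by apply/esym/eqP.
rewrite -tot (eq_bigl _ _ (@partial_tab0 d n la)) big_pred1_eq /g.
have m0 : mT ([ffun=> ord0] : filling d n) = 0.
  by apply: big1 => c _; rewrite ffunE.
rewrite /tab_weight m0 big_geq // mul1r; apply: fext => i.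
by apply: eq_card0 => j; rewrite !inE ffunE.
Qed.

(** * Hook lengths of a row *)

(** The quotient of the two products telescopes to [(x + e.+1) / (x + 1 + e - t)]. *)
Lemma hook_prod_aux e x t : t <= x ->
  (\prod_(1 <= j < t.+1) (x - j + 1 + e.+1)) * (x + 1 + e - t) =
  (x + e.+1) * \prod_(1 <= j < t.+1) (x - j + 1 + e).
Proof.
elim: t => [|t IH] tx; first by rewrite !big_nil; lia.
rewrite !(big_nat_recr t.+1) //= mulnA -IH ?(ltnW tx) //.
have -> : x + 1 + e - t.+1 = x - t.+1 + 1 + e by lia.
have -> : x + 1 + e - t = x - t.+1 + 1 + e.+1 by lia.
ring.
Qed.

(** Frobenius' formula for a row of length [x] above rows [l 0, ..., l e.-1], by induction on [e]. A
    further row lengthens the legs of the columns [j <= l e] only; there all previous rows reach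
    column [j], so the legs grow from [e] to [e.+1] and the quotient telescopes. *)
Lemma hook_prod (l : nat -> nat) (e x : nat) :
  (forall k, l k.+1 <= l k) -> l 0 <= x ->
  \prod_(1 <= j < x.+1) (x - j + 1 + \sum_(0 <= k < e) (j <= l k)) *
  \prod_(0 <= k < e) (x + 1 + k - l k) = (x + e)`!.
Proof.
move=> dl l0; have anti k m : k <= m -> l m <= l k.
  elim: m => [|m IH]; first by rewrite leqn0 => /eqP ->.
  by rewrite leq_eqVlt => /predU1P[-> //|km]; apply: leq_trans (dl m) (IH km).
have lx k : l k <= x by apply: leq_trans l0; apply: anti.
elim: e => [|e IH].
  rewrite [X in _ * X]big_nil muln1 addn0 fact_prod big_nat_rev /=.
  by apply: eq_big_nat => j jx; rewrite big_nil; lia.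
have le := lx e.
suff E : (\prod_(1 <= j < x.+1) (x - j + 1 + \sum_(0 <= k < e.+1) (j <= l k))) *
    (x + 1 + e - l e) =
    (x + e.+1) * \prod_(1 <= j < x.+1) (x - j + 1 + \sum_(0 <= k < e) (j <= l k)).
  rewrite [X in _ * X]big_nat_recr //= (mulnC _ (x + 1 + e - l e)) mulnA E.
  by rewrite -mulnA IH addnS factS.
rewrite !(big_cat_nat (n := (l e).+1) (m := 1) (p := x.+1)) //=.
rewrite mulnAC [RHS]mulnA; congr (_ * _).
  rewrite [X in X * _](eq_big_nat _ _ (F2 := fun j => x - j + 1 + e.+1)) => [|j /andP[_ jt]].
    rewrite hook_prod_aux //; congr (_ * _); apply: eq_big_nat => j /andP[_ jt].
    congr (_ + _); rewrite big_nat (eq_bigr (fun=> 1)) => [|k /andP[_ ke]].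
      by rewrite -big_nat sum_nat_const_nat subn0 muln1.
    by have := anti _ _ (ltnW ke); case: leqP; lia.
  congr (_ + _); rewrite big_nat (eq_bigr (fun=> 1)) => [|k /andP[_ ke]].
    by rewrite -big_nat sum_nat_const_nat subn0 muln1.
  by have := anti k e ke; case: leqP; lia.
apply: eq_big_nat => j /andP[tj _]; rewrite big_nat_recr //=.
by rewrite (leqNgt j) tj addn0.
Qed.

Local Open Scope ring_scope.

Lemma partition_nth (lam : seq nat) i j :
  is_partition lam -> (i <= j)%N -> (nth 0%N lam j <= nth 0%N lam i)%N.
Proof.
move=> /andP[srt _] ij; have [js|sj] := ltnP j (size lam); last by rewrite nth_default.
apply: (sorted_leq_nth (leT := geq)) => //.
- by move=> x y z xy yz; apply: leq_trans yz xy.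
- exact: leqnn.
- exact: leq_ltn_trans ij js.
Qed.

(** [hook_prod] for the rows below row [i], padded by empty rows to [d - i.+1] rows. *)
Lemma hook_row d (lam : seq nat) (i : nat) :
  is_partition lam -> (size lam <= d)%N -> (i < d)%N ->
  ((\prod_(1 <= j < (part lam i.+1).+1) hook lam i.+1 j) *
   \prod_(k < d | i < k) ((part lam i.+1 + (d - i)) - (part lam k.+1 + (d - k))) =
   (part lam i.+1 + (d - i.+1))`!)%N.
Proof.
move=> plam sd id; have anti a b := @partition_nth _ a b plam.
have H := @hook_prod (fun k => nth 0 lam (k + i.+1))%N (d - i.+1) (nth 0 lam i)%N.
rewrite /part /= -H; [|by move=> k; apply: anti; lia|by apply: anti; lia].
congr (_ * _)%N.
  apply: eq_big_nat => j /andP[j1 jx]; rewrite /hook /part /=.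
  have -> : conj_part lam j = (i.+1 + \sum_(0 <= k < d - i.+1) (j <= nth 0 lam (k + i.+1)))%N.
    have -> : conj_part lam j = (\sum_(0 <= k < d) (j <= nth 0 lam k))%N.
      rewrite /conj_part -sum1_count big_mkcond /= (big_nth 0%N).
      rewrite (big_cat_nat (n := size lam) (p := d)) //= [X in (_ + X)%N]big_nat_cond.
      rewrite [X in (_ + X)%N]big1 ?addn0 => [|k /andP[/andP[sk _] _]].
        by apply: eq_bigr => k _; case: leqP.
      by rewrite nth_default //; case: j j1 {jx}.
    (* Row [i] and all rows above it reach column [j]; the remaining count is the leg. *)
    rewrite (big_cat_nat (n := i.+1)) //= -{2}[i.+1]add0n big_addn; congr (_ + _)%N.
    rewrite big_nat (eq_bigr (fun=> 1%N)) => [|k /andP[_ ki]].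
      by rewrite -big_nat sum_nat_const_nat subn0 muln1.
    by rewrite (leq_trans _ (anti k i ki)).
  lia.
rewrite (big_ord_gt _ _ _ (fun k => (nth 0 lam i + (d - i)) - (nth 0 lam k + (d - k)))%N).
apply: eq_big_nat => k /andP[_ ke]; have := anti i (k + i.+1)%N; lia.
Qed.

(* At [y i = 1 / c (la_i + d - i + 1)] the Chevalley factor becomes the
   weight ratio of the theorem, and shapes not contained in [la] contribute 0. *)
Lemma groth_tableau_sum (F : fieldType) (c : nat -> F) d n (la : 'I_d -> nat) :
  antitone la -> (\sum_i la i)%N = n -> (forall m, c m != 0) ->
  (forall nu : 'I_d -> nat, (forall i, (nu i <= la i)%N) -> (exists i, (nu i < la i)%N) ->
     \prod_i (c (beta_index nu i).+1 / c (beta_index la i).+1) != 1) ->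
  let y i := (c (beta_index la i).+1)^-1 in
  let u nu := \prod_i (c (beta_index nu i).+1 / c (beta_index la i).+1) in
  (\sum_(T : filling d n | partial_tab la T && [forall i, row_len T i == la i])
      tab_weight u T) * \prod_i (shiftp c (beta_index la i) (y i) * y i ^+ i) =
  \prod_(i < d) \prod_(j < d | (i < j)%N) (y i - y j).
Proof.
move=> ala sla c0 une y u; rewrite -(groth_diag ala c0) -(groth_empty c).
apply: (sum_full_tabs (f := fun nu => \det (groth_mx c y nu)) sla).
- by move=> nu mu e; apply: eq_bigr => i _; rewrite /beta_index e.
- by move=> nu mu e; congr (\det _); apply/matrixP => i j; rewrite !mxE /beta_index e.
move=> nu anu le lt; split; first exact: une.
have -> : u nu = \prod_i (y i * c (beta_index nu i).+1).
  by apply: eq_bigr => i _; rewrite mulrC.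
rewrite mulrBl mul1r /= groth_chevalley //.
(* The term of the empty set is the determinant at [nu] itself; it cancels the [- 1] in
   [u nu - 1]. *)
rewrite (bigD1 set0) /=; last by apply/forall_inP => i; rewrite inE.
have -> : \det (groth_mx c y (add_cells nu set0)) = \det (groth_mx c y nu).
  by congr (\det _); apply/matrixP => i j; rewrite !mxE /beta_index /add_cells inE addn0.
rewrite [LHS]addrC addKr.
rewrite (bigID (fun S : {set 'I_d} => [forall i in S, (nu i < la i)%N])) /=.
rewrite [X in _ + X]big1 ?addr0 => [|S /andP[/andP[/forall_inP cS S0]]].
  apply: eq_bigl => S; rewrite [_ && (S != _)]andbC -andbA; congr (_ && _).
  apply/andP/forall_inP => [[/forall_inP h1 /forall_inP h2] i iS|h].
    by rewrite h1 ?h2.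
  by split; apply/forall_inP => i /h /andP[].
(* The enlarged shape leaves [la] in row [k], and it is still antitone because [S] consists of
   corners. *)
move=> /forall_inPn[k kS]; rewrite -leqNgt => lk.
apply: (groth_vanish (k := k)) => //; last by rewrite /add_cells kS; lia.
move=> i j; rewrite leq_eqVlt => /predU1P[/val_inj -> //|ij].
have := anu i j (ltnW ij); rewrite /add_cells.
have [/cS/forallP/(_ i)/implyP/(_ ij)|_] := boolP (j \in S); lia.
Qed.

(** * Nonvanishing in the field of rational functions *)

Lemma natr_RF (m : nat) : m%:R = FracField.tofrac (m%:R : {poly rat}) :> RF.
Proof. by rewrite rmorph_nat. Qed.

Lemma natr_RF_eq0 (m : nat) : (m%:R == 0 :> RF) = (m == 0%N).
Proof. by rewrite natr_RF tofrac_eq0 -polyC_natr polyC_eq0 pnatr_eq0. Qed.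

Lemma beta_neq0 : beta != 0.
Proof. by rewrite /beta tofrac_eq0 polyX_eq0. Qed.

Lemma lin_RF (m : nat) : 1 + beta * m%:R = FracField.tofrac (1 + 'X * m%:R : {poly rat}).
Proof. by rewrite rmorphD rmorph1 rmorphM rmorph_nat. Qed.

Lemma lin_RF_neq0 (m : nat) : 1 + beta * m%:R != 0.
Proof.
rewrite lin_RF tofrac_eq0; apply/eqP => /(congr1 (fun p => p.[0])) /eqP.
by rewrite !hornerE ?mul0r ?addr0 oner_eq0.
Qed.

(* Evaluate at [beta = 1]. *)
Lemma lin_prod_neq1 d (a b : 'I_d -> nat) :
  (forall i, (a i <= b i)%N) -> (exists i, (a i < b i)%N) ->
  \prod_i ((1 + beta * (a i)%:R) / (1 + beta * (b i)%:R)) != 1.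
Proof.
move=> ab [i0 lt0]; rewrite big_split /= prodfV.
(* Clearing denominators gives an equality of polynomials; at [1] their factors are [(a i).+1] and
   [(b i).+1]. *)
apply/eqP => /(congr1 ( *%R^~ (\prod_i (1 + beta * (b i)%:R)))).
rewrite mul1r mulfVK; last by apply/prodf_neq0 => i _; apply: lin_RF_neq0.
under eq_bigr do rewrite lin_RF.
under [RHS]eq_bigr do rewrite lin_RF.
rewrite -!rmorph_prod => /eqP; rewrite tofrac_eq => /eqP /(congr1 (fun p => p.[1])).
rewrite !horner_prod.
have ev (m : nat) : (1 + 'X * m%:R : {poly rat}).[1] = m.+1%:R.
  by rewrite -polyC_natr !hornerE ?mul1r -natr1 addrC.
under eq_bigr do rewrite ev.
under [RHS]eq_bigr do rewrite ev.
rewrite -!natr_prod => /eqP; rewrite eqr_nat => /eqP.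
rewrite (bigD1 i0) //= [RHS](bigD1 i0) //=.
have le : (\prod_(i | i != i0) (a i).+1 <= \prod_(i | i != i0) (b i).+1)%N.
  by apply: leq_prod => i _; rewrite ltnS ab.
have p0 : (0 < \prod_(i | i != i0) (a i).+1)%N by apply: prodn_gt0.
apply/eqP; rewrite ltn_eqF //.
apply: (@leq_trans ((b i0).+1 * \prod_(i | i != i0) (a i).+1)%N).
  by rewrite ltn_pmul2r.
by rewrite leq_mul2l le orbT.
Qed.

(** * Evaluation *)

Lemma part_leq_sumn (lam : seq nat) i : (part lam i.+1 <= sumn lam)%N.
Proof.
rewrite /part /=; elim: lam i => [|x lam IH] [|i] //=; first exact: leq_addr.
exact: leq_trans (IH i) (leq_addl _ _).
Qed.

Lemma sum_part d (lam : seq nat) : (size lam <= d)%N ->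
  (\sum_(i < d) part lam i.+1)%N = sumn lam.
Proof.
move=> sd; rewrite sumnE (big_nth 0%N) -(big_mkord xpredT (fun i => part lam i.+1)).
rewrite (big_cat_nat (n := size lam)) //= [X in (_ + X)%N]big_nat [X in (_ + X)%N]big1 ?addn0 //.
by move=> i /andP[si _]; rewrite /part nth_default.
Qed.

(** Full rows make the positive cells coincide with the cells of [lam]; the bound on [sumn lam] lets
    each row fit into [n] columns. *)
Lemma is_SIT_partial_tab d n (lam : seq nat) (T : filling d n) :
  is_partition lam -> (sumn lam <= n)%N ->
  is_SIT lam T = partial_tab (fun i : 'I_d => part lam i.+1) T &&
                 [forall i, row_len T i == part lam i.+1].
Proof.
move=> plam sn.
have anti (i i' : 'I_d) : (i < i')%N -> (part lam i'.+1 <= part lam i.+1)%N.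
  by move=> ii'; apply: partition_nth => //; apply: ltnW.
rewrite /is_SIT; apply/idP/idP.
  move=> /andP[/andP[/andP[/forallP h1 /forallP h2] /forallP h3] /forallP h4].
  have sh c : (0 < T c)%N = in_shape lam c by have /eqP := h1 c.
  apply/andP; split; last first.
    apply/forallP => i; rewrite -[X in _ == X](@card_ord_lt n); last first.
      exact: leq_trans (part_leq_sumn _ _) sn.
    by apply/eqP; apply: eq_card => j; rewrite !inE sh.
  apply/partial_tabP; split.
  - by move=> i j; rewrite sh.
  - move=> i j j' jj'; rewrite !sh => Tj'.
    have Tj : in_shape lam (i, j) by apply: ltn_trans Tj'.
    have /forallP/(_ (i, j'))/implyP := h2 (i, j).
    by rewrite Tj Tj' /= eqxx jj' => ->.
  - move=> i i' j ii'; rewrite !sh => Tj'.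
    have Tj : in_shape lam (i, j) by apply: leq_trans Tj' (anti _ _ ii').
    have /forallP/(_ (i', j))/implyP := h3 (i, j).
    by rewrite Tj Tj' /= eqxx ii' => ->.
  - move=> k km; have kn : (k < n.+1)%N.
      have : (mT T <= n)%N by apply/bigmax_leqP => c _; rewrite -ltnS.
      lia.
    have /implyP/(_ km)/existsP[c /andP[_ /eqP e]] := h4 (Ordinal kn).
    by exists c; rewrite e.
move=> /andP[pT /forallP rT]; have /partial_tabP[h1 h2 h3 h4] := pT.
have sh c : (0 < T c)%N = in_shape lam c.
  by case: c => i j; rewrite (row_lenP _ _ pT) (eqP (rT i)).
apply/andP; split; first (apply/andP; split; first (apply/andP; split)).
- by apply/forallP => c; rewrite sh.
- apply/forallP => -[i j]; apply/forallP => -[i' j']; apply/implyP => /=.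
  rewrite -!sh => /andP[/andP[/andP[_ T0] /eqP e] jj']; rewrite e in T0 *.
  by have /andP[] := h2 _ _ _ jj' T0.
- apply/forallP => -[i j]; apply/forallP => -[i' j']; apply/implyP => /=.
  rewrite -!sh => /andP[/andP[/andP[_ T0] /eqP e] ii']; rewrite -e in T0 *.
  by have /andP[] := h3 _ _ _ ii' T0.
- apply/forallP => k; apply/implyP => km; have [c e] := h4 _ km.
  apply/existsP; exists c; rewrite -sh; apply/andP; split; last exact/eqP/val_inj.
  by rewrite e; case/andP: km.
Qed.

(** With [y] the point of evaluation, the factor of index [m] equals [- b * y * (l - m)]. *)
Lemma shiftp_linear (F : fieldType) (b : F) (l : nat) : 1 + b * l.+1%:R != 0 ->
  shiftp (fun m => 1 + b * m%:R) l (1 + b * l.+1%:R)^-1 =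
  (- b / (1 + b * l.+1%:R)) ^+ l * (l`!)%:R.
Proof.
move=> N0; rewrite /shiftp.
transitivity (\prod_(m < l) ((- b / (1 + b * l.+1%:R)) * (l - m)%:R)).
  apply: eq_bigr => m _; rewrite natrB; last exact: ltnW.
  by rewrite -!natr1 in N0 *; field.
rewrite big_split /= prodr_const card_ord -natr_prod; congr (_ * _%:R).
by rewrite -ffact_prod ffactnn.
Qed.

Lemma inv_linear_sub (F : fieldType) (b : F) (m k : nat) : (k <= m)%N ->
  1 + b * m%:R != 0 -> 1 + b * k%:R != 0 ->
  (1 + b * m%:R)^-1 - (1 + b * k%:R)^-1 =
  (- b / (1 + b * m%:R)) * (m - k)%:R * (1 + b * k%:R)^-1.
Proof. by move=> km m0 k0; rewrite natrB //; field; rewrite m0 k0. Qed.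

(** The final identity for one row: [b] is [- beta], [l] the part, [e = d - i.+1], [h] the hook
    product, [v] the product of the differences [N i - N k], and [z = y ^+ i]. *)
Lemma groth_ratio_row (F : fieldType) (b y h v z : F) (l e : nat) :
  b != 0 -> y != 0 -> h != 0 ->
  (b ^+ l)^-1 * y^-1 ^+ l * h^-1 * ((b * y) ^+ (l + e) * (h * v) * z) =
  (b * y) ^+ e * v * z.
Proof.
move=> b0 y0 h0; rewrite exprD exprMn exprVn.
have := expf_neq0 l b0; have := expf_neq0 l y0.
by move: (b ^+ l) (y ^+ l) => p q q0 p0; field; rewrite q0 p0 h0.
Qed.

(** Each [y j] occurs once for every [i < j]; this regroups the second factors of the Vandermonde
    differences by rows. *)
Lemma prod_pairs_snd (F : fieldType) d (y : 'I_d -> F) :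
  \prod_(i < d) \prod_(j < d | (i < j)%N) y j = \prod_(j < d) y j ^+ j.
Proof.
rewrite (exchange_big_dep xpredT) //=; apply: eq_bigr => j _.
rewrite prodr_const; congr (_ ^+ _).
by rewrite -[RHS](@card_ord_lt d) ?(ltnW (ltn_ord j)) // cardsE.
Qed.

Lemma prod_rows (F : fieldType) d s (G : nat -> F) : (s <= d)%N ->
  (forall i, (s < i)%N -> G i = 1) ->
  \prod_(1 <= i < s.+1) G i = \prod_(i < d) G i.+1.
Proof.
move=> sd G1; rewrite big_add1 /= -(big_mkord xpredT (fun i => G i.+1)).
rewrite [RHS](big_cat_nat (n := s)) //= [X in _ * X]big_nat [X in _ * X]big1 ?mulr1 //.
by move=> i /andP[si _]; apply: G1.
Qed.

Unset Implicit Arguments.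

Theorem theorem1p1 (d n : nat) (lam : seq nat) :
  (1 <= d)%N -> is_partition lam -> sumn lam = n -> (size lam <= d)%N ->
  \sum_(T : filling d n | is_SIT lam T)
     \prod_(1 <= k < (mT T).+1)
       ((\prod_(i < d)
           ((1 + beta * ((nu_part lam T k i + d - i)%N)%:R) /
            (1 + beta * ((part lam i.+1 + d - i)%N)%:R))) - 1)^-1
  = ((- beta) ^+ n)^-1 *
    (\prod_(1 <= i < (size lam).+1)
        (1 + beta * ((part lam i + d - i + 1)%N)%:R) ^+ part lam i) *
    \prod_(1 <= i < (size lam).+1) \prod_(1 <= j < (part lam i).+1)
        ((hook lam i j)%:R)^-1.
Proof.
move=> _ plam sn sd.
pose la (i : 'I_d) := part lam i.+1.
pose c (m : nat) : RF := 1 + beta * m%:R.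
(* [N i] is [lambda_i + d - i + 1] for the 1-indexed row. *)
pose N (i : 'I_d) := (beta_index la i).+1.
pose y i := (c (N i))^-1.
have c0 m : c m != 0 by apply: lin_RF_neq0.
have ala : antitone la by move=> i j ij; apply: partition_nth.
have sla : (\sum_i la i)%N = n by rewrite sum_part.
have une (nu : 'I_d -> nat) : (forall i, (nu i <= la i)%N) -> (exists i, (nu i < la i)%N) ->
    \prod_i (c (beta_index nu i).+1 / c (beta_index la i).+1) != 1.
  move=> le [i lt]; apply: lin_prod_neq1 => [k|]; first by rewrite ltnS leq_add2r le.
  by exists i; rewrite ltnS ltn_add2r.
have := groth_tableau_sum ala sla c0 une.
rewrite /= => main.
have partE i : (part lam (nat_of_ord i).+1 + d - i)%N = N i.
  by rewrite /N /beta_index /la; have := ltn_ord i; lia.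
(* [f] and [f0] are the determinants at [la] and at the empty shape; [main] says that the sum times
   [f] is [f0]. *)
pose f := \prod_i (shiftp c (beta_index la i) (y i) * y i ^+ i).
pose f0 := \prod_(i < d) \prod_(j < d | (i < j)%N) (y i - y j).
have y0 i : y i != 0 by rewrite invr_eq0.
have b0 : - beta != 0 by rewrite oppr_eq0 beta_neq0.
have fE : f = \prod_i ((- beta * y i) ^+ beta_index la i * (beta_index la i)`!%:R * y i ^+ i).
  apply: eq_bigr => i _; congr (_ * _); apply: shiftp_linear; exact: lin_RF_neq0.
have f_neq0 : f != 0.
  rewrite fE; apply/prodf_neq0 => i _.
  apply: mulf_neq0; last exact/expf_neq0/y0.
  apply: mulf_neq0; first by apply/expf_neq0/mulf_neq0; [exact: b0|exact: y0].
  by rewrite natr_RF_eq0 -lt0n fact_gt0.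
(* Here [y i - y k = - beta * y i * (N i - N k) * y k], and the factors [y k] regroup into the
   powers [y i ^+ i] also present in [f]. *)
have f0E : f0 = \prod_i ((- beta * y i) ^+ (d - i.+1) *
                 (\prod_(k < d | (i < k)%N) (N i - N k))%N%:R * y i ^+ i).
  rewrite big_split /= -prod_pairs_snd -big_split; apply: eq_bigr => i _ /=.
  rewrite -prodr_const_gt natr_prod -!big_split; apply: eq_bigr => j ij /=.
  have NN : (N j <= N i)%N.
    by have := ala i j (ltnW ij); rewrite /N /beta_index; lia.
  exact: inv_linear_sub NN (lin_RF_neq0 _) (lin_RF_neq0 _).
apply: (mulIf f_neq0); transitivity f0.
  apply: (etrans _ main); congr (_ * _); apply: eq_big => [T|T sT].
    by apply: is_SIT_partial_tab; rewrite ?sn.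
  apply: eq_bigr => k _; congr ((_ - 1)^-1); apply: eq_bigr => i _.
  rewrite partE; congr (_ / _); rewrite /c; congr (1 + beta * _%:R).
  have -> : nu_part lam T k i = below T k i.
    have := sT; rewrite is_SIT_partial_tab ?sn // => /andP[pT /forallP rT].
    apply: eq_card => j; rewrite !inE (row_lenP _ _ pT) (eqP (rT i)).
    by rewrite /in_shape.
  by rewrite /beta_index; have := ltn_ord i; lia.
(* Rows beyond the length of [lam] have part [0] and contribute [1], so both products extend to [d]
   rows. *)
rewrite (prod_rows sd) => [|i si]; last by rewrite /part nth_default ?expr0 //; case: i si.
rewrite (prod_rows sd) => [|i si]; last first.
  by rewrite /part nth_default ?big_geq //; case: i si.
(* As [n] is the sum of the parts, [(- beta) ^+ n] also splits over the rows. *)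
rewrite -sla (big_morph _ (exprD (- beta)) (expr0 _)) -prodfV fE f0E -!big_split.
apply: eq_bigr => i _ /=.
have hk := hook_row plam sd (ltn_ord i).
have hk' : (\prod_(1 <= j < (la i).+1) hook lam i.+1 j *
   \prod_(k < d | (i < k)%N) (N i - N k) = (beta_index la i)`!)%N.
  rewrite -hk; congr (_ * _)%N; apply: eq_bigr => k _; rewrite -!partE.
  by have := ltn_ord i; have := ltn_ord k; lia.
rewrite prodfV -natr_prod -hk' natrM.
have h0 : (\prod_(1 <= j < (la i).+1) hook lam i.+1 j)%N%:R != 0 :> RF.
  rewrite natr_RF_eq0; apply/eqP => e; move: hk'; rewrite e mul0n => /esym/eqP.
  by rewrite eqn0Ngt fact_gt0.
have -> : (part lam i.+1 + d - i.+1 + 1)%N = N i.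
  by rewrite /N /beta_index /la; have := ltn_ord i; lia.
rewrite -/(c (N i)) -/(la i) {1}/beta_index.
have -> : c (N i) = (y i)^-1 by rewrite invrK.
exact: (esym (groth_ratio_row _ _ _ _ b0 (y0 i) h0)).
Qed.
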